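(* For each integer $n\geq 1$, there exist infinitely many (pairwise non-isomorphic) finite simplicial graphs $\Gamma$ such that both $|\mathrm{Out}(\mathrm{Aut}(A_\Gamma))|>n$ and $|\mathrm{Out}(\mathrm{Out}(A_\Gamma))|>n$.
   Context: For a finite simplicial graph $\Gamma$ with vertex set $V$, the right-angled Artin group $A_\Gamma$ is the group with generating set $V$ and relations $uv=vu$ for each pair of adjacent vertices $u,v$. For a group $G$, $\mathrm{Out}(G)=\mathrm{Aut}(G)/\mathrm{Inn}(G)$. *)

(* Defs.v *)
From HB Require Import structures.
From mathcomp Require Import all_boot.
From mathcomp Require Import boolp classical_sets cardinality.

Set Implicit Arguments.
Unset Strict Implicit.
Unset Printing Implicit Defensive.

Local Open Scope group_scope.
Local Open Scope quotient_scope.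

Record sgraph := SGraph {
  vertex :> finType;
  adj : rel vertex;
  adj_sym : symmetric adj;
  adj_irr : irreflexive adj }.

Definition sgraph_iso (X Y : sgraph) : Prop :=
  exists2 f : X -> Y, bijective f & {mono f : x y / adj x y}.

Section Presentation.
Variables (X : choiceType) (R : seq (X * bool) -> seq (X * bool) -> Prop).

(* The letter (x, true) stands for x and (x, false) for x^-1. *)
Definition word : Type := seq (X * bool).

Definition winv (w : word) : word := rev [seq (l.1, ~~ l.2) | l <- w].

(* The congruence generated by free cancellation and the relations u = v
   for R u v: two words are related iff they define the same element of
   the group < X | R >. *)
Inductive pres_cong : word -> word -> Prop :=
| pres_refl u : pres_cong u u
| pres_sym u v : pres_cong u v -> pres_cong v u
| pres_trans u v w : pres_cong u v -> pres_cong v w -> pres_cong u w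
| pres_cat u u' v v' :
    pres_cong u u' -> pres_cong v v' -> pres_cong (u ++ v) (u' ++ v')
| pres_cancel x b : pres_cong [:: (x, b); (x, ~~ b)] [::]
| pres_rel u v : R u v -> pres_cong u v.

Definition pres_congb : rel word := fun u v => `[< pres_cong u v >].

Lemma pres_congb_refl : reflexive pres_congb.
Proof. by move=> u; apply/asboolP; apply: pres_refl. Qed.

Lemma pres_congb_sym : symmetric pres_congb.
Proof. by move=> u v; apply/asboolP/asboolP => /pres_sym. Qed.

Lemma pres_congb_trans : transitive pres_congb.
Proof.
by move=> v u w /asboolP uv /asboolP vw; apply/asboolP; apply: pres_trans vw.
Qed.

Canonical pres_equiv :=
  EquivRel pres_congb pres_congb_refl pres_congb_sym pres_congb_trans.

Definition presented : Type := {eq_quot pres_equiv}.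
HB.instance Definition _ : EqQuotient _ pres_equiv presented :=
  EqQuotient.on presented.
HB.instance Definition _ := Choice.on presented.

Lemma presP (u v : word) : pres_cong u v <-> \pi_presented u = \pi_presented v.
Proof.
split=> [uv|/eqP]; first by apply/eqP; rewrite piE; apply/asboolP.
by rewrite piE => /asboolP.
Qed.

Lemma winv_cat u v : winv (u ++ v) = winv v ++ winv u.
Proof. by rewrite /winv map_cat rev_cat. Qed.

Lemma winvK : involutive winv.
Proof.
move=> w; rewrite /winv map_rev revK -map_comp map_id_in // => -[x b] _ /=.
by rewrite negbK.
Qed.

Lemma pres_winv_r u : pres_cong (u ++ winv u) [::].
Proof.
elim: u => [|[x b] u IHu]; first exact: pres_refl.
rewrite -cat1s winv_cat catA -(catA [:: _] u).
apply: (pres_trans (pres_cat (pres_cat (pres_refl _) IHu) (pres_refl _))).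
exact: pres_cancel.
Qed.

Lemma pres_winv_l u : pres_cong (winv u ++ u) [::].
Proof. by have := pres_winv_r (winv u); rewrite winvK. Qed.

Lemma pres_winv u v : pres_cong u v -> pres_cong (winv u) (winv v).
Proof.
move=> uv; rewrite -[winv u]cats0.
apply: (pres_trans (pres_cat (pres_refl _) (pres_sym (pres_winv_r v)))).
rewrite catA -[X in pres_cong _ X]cat0s; apply: pres_cat; last exact: pres_refl.
apply: pres_trans (pres_winv_l u).
by apply: pres_cat (pres_refl _) (pres_sym uv).
Qed.

Definition pres_one : presented := \pi_presented [::].
Definition pres_mul (a b : presented) : presented :=
  \pi_presented (repr a ++ repr b).
Definition pres_inv (a : presented) : presented := \pi_presented (winv (repr a)).

Lemma pres_mul_pi u v :
  pres_mul (\pi_presented u) (\pi_presented v) = \pi_presented (u ++ v).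
Proof. by apply/presP/pres_cat; apply/presP; rewrite reprK. Qed.

Lemma pres_inv_pi u : pres_inv (\pi_presented u) = \pi_presented (winv u).
Proof. by apply/presP/pres_winv; apply/presP; rewrite reprK. Qed.

Lemma pres_mulA : associative pres_mul.
Proof.
elim/quotW=> u; elim/quotW=> v; elim/quotW=> w.
rewrite (pres_mul_pi v w) (pres_mul_pi u v) (pres_mul_pi u (v ++ w)).
by rewrite (pres_mul_pi (u ++ v) w) catA.
Qed.

Lemma pres_mul1 : left_id pres_one pres_mul.
Proof. by move=> a; rewrite -[a]reprK /pres_one pres_mul_pi. Qed.

Lemma pres_mulr1 : right_id pres_one pres_mul.
Proof. by move=> a; rewrite -[a]reprK /pres_one pres_mul_pi cats0. Qed.

Lemma pres_mulV : left_inverse pres_one pres_inv pres_mul.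
Proof.
move=> a; rewrite -[a]reprK pres_inv_pi pres_mul_pi.
exact/presP/pres_winv_l.
Qed.

Lemma pres_mulrV : right_inverse pres_one pres_inv pres_mul.
Proof.
move=> a; rewrite -[a]reprK pres_inv_pi pres_mul_pi.
exact/presP/pres_winv_r.
Qed.

HB.instance Definition _ := isGroup.Build presented
  pres_mulA pres_mul1 pres_mulr1 pres_mulV pres_mulrV.

End Presentation.

Definition raag_rel (X : sgraph) (u v : seq (X * bool)) : Prop :=
  exists x y : X, [/\ adj x y, u = [:: (x, true); (y, true)]
                           & v = [:: (y, true); (x, true)]].

Definition raag (X : sgraph) : groupType := presented (@raag_rel X).

Section Automorphisms.
Variable G : groupType.

Definition is_aut : pred (G -> G) :=
  fun f => `[< {morph f : x y / x * y} /\ bijective f >].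

Record aut : Type := MkAut { aut_fun :> G -> G; aut_funP : is_aut aut_fun }.

HB.instance Definition _ := [isSub for aut_fun].
HB.instance Definition _ := [Choice of aut by <:].

Lemma autP (f g : aut) : f =1 g -> f = g.
Proof. by move=> fg; apply: val_inj; apply: funext. Qed.

Lemma aut_morph (f : aut) : {morph f : x y / x * y}.
Proof. by case: f => f /= /asboolP[]. Qed.

Lemma aut_bij (f : aut) : bijective f.
Proof. by case: f => f /= /asboolP[]. Qed.

Lemma aut_one_subproof : is_aut id.
Proof. by apply/asboolP; split=> //; exists id. Qed.

Lemma aut_mul_subproof (f g : aut) : is_aut (f \o g).
Proof.
apply/asboolP; split; first by move=> x y /=; rewrite !aut_morph.
exact: bij_comp (aut_bij f) (aut_bij g).
Qed.

Lemma aut_inv_ex (f : aut) : exists g : G -> G, cancel f g /\ cancel g f.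
Proof. by have [g fK gK] := aut_bij f; exists g. Qed.

Definition aut_inv_fun (f : aut) : G -> G := sval (cid (aut_inv_ex f)).

Lemma aut_inv_funK (f : aut) : cancel f (aut_inv_fun f).
Proof. by rewrite /aut_inv_fun; case: cid => g /= []. Qed.

Lemma aut_inv_funVK (f : aut) : cancel (aut_inv_fun f) f.
Proof. by rewrite /aut_inv_fun; case: cid => g /= []. Qed.

Lemma aut_inv_subproof (f : aut) : is_aut (aut_inv_fun f).
Proof.
apply/asboolP; split; last first.
  by exists f; [exact: aut_inv_funVK | exact: aut_inv_funK].
move=> x y; apply: (can_inj (aut_inv_funK f)).
by rewrite aut_morph !aut_inv_funVK.
Qed.

Definition aut_one : aut := MkAut aut_one_subproof.
Definition aut_mul (f g : aut) : aut := MkAut (aut_mul_subproof f g).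
Definition aut_inv (f : aut) : aut := MkAut (aut_inv_subproof f).

Lemma aut_mulA : associative aut_mul.
Proof. by move=> f g h; apply: autP. Qed.

Lemma aut_mul1 : left_id aut_one aut_mul.
Proof. by move=> f; apply: autP. Qed.

Lemma aut_mulr1 : right_id aut_one aut_mul.
Proof. by move=> f; apply: autP. Qed.

Lemma aut_mulV : left_inverse aut_one aut_inv aut_mul.
Proof. by move=> f; apply: autP => x /=; rewrite aut_inv_funK. Qed.

Lemma aut_mulrV : right_inverse aut_one aut_inv aut_mul.
Proof. by move=> f; apply: autP => x /=; rewrite aut_inv_funVK. Qed.

HB.instance Definition _ := isGroup.Build aut
  aut_mulA aut_mul1 aut_mulr1 aut_mulV aut_mulrV.

Definition inner (f : aut) : Prop := exists g : G, forall x, f x = x ^ g.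

Lemma inner1 : inner 1.
Proof. by exists 1 => x; rewrite conjg1. Qed.

Lemma innerM f g : inner f -> inner g -> inner (f * g).
Proof.
by move=> [a fa] [b gb]; exists (b * a) => x; rewrite conjgM -gb -fa.
Qed.

Lemma innerV f : inner f -> inner f^-1.
Proof.
move=> [a fa]; exists a^-1 => x; apply: (can_inj (aut_inv_funK f)).
by rewrite [RHS]fa conjgKV; apply: aut_inv_funVK.
Qed.

Lemma innerJ f g : inner f -> inner (f ^ g).
Proof.
move=> [a fa]; exists (g^-1 a) => x.
have gV : {morph g^-1 : y z / y * z} := aut_morph g^-1.
have gVV y : g^-1 y^-1 = (g^-1 y)^-1.
  apply/esym/mulg1_eq; rewrite -gV mulgV.
  by apply: (mulgI (g^-1 1)); rewrite -gV !mulg1.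
rewrite /conjg -[LHS]/(g^-1 (f (g x))) fa /conjg !gV gVV.
by have -> : g^-1 (g x) = x by apply: aut_inv_funK.
Qed.

(* out is Aut(G)/Inn(G): f ~ g iff f Inn(G) = g Inn(G). *)
Definition out_rel : rel aut := fun f g => `[< inner (f^-1 * g) >].

Lemma out_rel_refl : reflexive out_rel.
Proof. by move=> f; apply/asboolP; rewrite mulVg; apply: inner1. Qed.

Lemma out_rel_sym : symmetric out_rel.
Proof.
by move=> f g; apply/asboolP/asboolP => /innerV; rewrite invgM invgK.
Qed.

Lemma out_rel_trans : transitive out_rel.
Proof.
move=> g f h /asboolP fg /asboolP gh; apply/asboolP.
by have := innerM fg gh; rewrite -mulgA mulVKg.
Qed.

Canonical out_equiv := EquivRel out_rel out_rel_refl out_rel_sym out_rel_trans.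

Definition out : Type := {eq_quot out_equiv}.
HB.instance Definition _ : EqQuotient _ out_equiv out := EqQuotient.on out.
HB.instance Definition _ := Choice.on out.

Lemma outP (f g : aut) : inner (f^-1 * g) <-> \pi_out f = \pi_out g.
Proof.
split=> [fg|/eqP]; first by apply/eqP; rewrite piE; apply/asboolP.
by rewrite piE => /asboolP.
Qed.

Definition out_one : out := \pi_out 1.
Definition out_mul (a b : out) : out := \pi_out (repr a * repr b).
Definition out_inv (a : out) : out := \pi_out (repr a)^-1.

Lemma out_mul_pi f g : out_mul (\pi_out f) (\pi_out g) = \pi_out (f * g).
Proof.
apply/outP; set f' := repr _; set g' := repr _.
have ff' : inner (f'^-1 * f) by apply/outP; rewrite reprK.
have gg' : inner (g'^-1 * g) by apply/outP; rewrite reprK.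
have -> : (f' * g')^-1 * (f * g) = (f'^-1 * f) ^ g' * (g'^-1 * g).
  by rewrite invgM /conjg !mulgA mulgK.
exact: innerM (innerJ _ ff') gg'.
Qed.

Lemma out_inv_pi f : out_inv (\pi_out f) = \pi_out f^-1.
Proof.
apply/outP; set f' := repr _; rewrite invgK.
have ff' : inner (f^-1 * f') by apply/outP; rewrite reprK.
have -> : f' * f^-1 = (f^-1 * f') ^ f^-1.
  by rewrite /conjg invgK !mulgA mulgV mul1g.
exact: innerJ.
Qed.

Lemma out_mulA : associative out_mul.
Proof.
elim/quotW=> u; elim/quotW=> v; elim/quotW=> w.
rewrite (out_mul_pi v w) (out_mul_pi u v) (out_mul_pi u (v * w)).
by rewrite (out_mul_pi (u * v) w) mulgA.
Qed.

Lemma out_mul1 : left_id out_one out_mul.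
Proof. by move=> a; rewrite -[a]reprK /out_one out_mul_pi mul1g. Qed.

Lemma out_mulr1 : right_id out_one out_mul.
Proof. by move=> a; rewrite -[a]reprK /out_one out_mul_pi mulg1. Qed.

Lemma out_mulV : left_inverse out_one out_inv out_mul.
Proof. by move=> a; rewrite -[a]reprK out_inv_pi out_mul_pi mulVg. Qed.

Lemma out_mulrV : right_inverse out_one out_inv out_mul.
Proof. by move=> a; rewrite -[a]reprK out_inv_pi out_mul_pi mulgV. Qed.

HB.instance Definition _ := isGroup.Build out
  out_mulA out_mul1 out_mulr1 out_mulV out_mulrV.

End Automorphisms.

(* |T| > n, with T possibly infinite. *)
Definition card_gt (T : Type) (n : nat) : Prop :=
  (`I_n.+1 #<= [set: T])%card.

(* Main.v *)
Require Import Defs.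
From HB Require Import structures.
From mathcomp Require Import ring zify.
From mathcomp Require Import all_boot all_order all_algebra.
From mathcomp Require Import boolp classical_sets functions cardinality.

(** Suppose that the centre of a group A is infinite cyclic, generated by z, and
    let m be a homomorphism from A to the integers with m z = 0.  The
    transvection x |-> x z^(m x) is an automorphism of A.  Its square root
    x |-> x z^(m x / 2) lives only in the group obtained by adjoining a square
    root of z, but conjugation by that square root makes sense: an automorphism
    f with f z = z^e (e = 1 or -1) becomes
      x |-> f x * z^((m (f x) - e * m x) / 2),
    which is again an automorphism of A as soon as m mod 2 is fixed by Aut A.
    This is an automorphism of Aut A.  It fixes the inner automorphisms of A,
    hence descends to Out A.  Neither of the two is inner when m takes an odd
    value: look at an automorphism that inverts z and moves every x by an
    even power of z.  All its conjugates move points by even powers of z (up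
    to conjugacy in A), while its twisted version moves x by an additional
    z^(m x).  So homomorphisms m that are invariant and pairwise distinct mod 2
    give distinct classes in both Out (Aut A) and Out (Out A)
    ([card_gt_out_aut_out]).

    It remains to find right-angled Artin groups with many such m.  Take the
    graph whose complement is the disjoint union of an isolated vertex, the
    apex, and of N stars, the i-th one having a hub and i + 2 leaves.  Then A is
    the direct product of Z (the apex) and of the groups Z * Z^(i + 2), and the
    homomorphisms used are the exponent sums of the N hubs.

    The centre is generated by the apex ([star_center]): each Z * Z^(i + 2) acts
    on pairs of integer polynomials by elementary transvections, the hub through
    one coordinate and the leaves through the other.  A central element fixes
    both axes, while by ping-pong a nontrivial alternating product moves one of
    them off itself ([ret_central_eq1]).

    The invariance mod 2 ([pull_hub]) comes from the cup product of H^1(A, F_2),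
    which is F_2^V for V the vertex set: the product of two classes vanishes iff
    they are symmetric along each edge ([cup0]), and this relation is preserved
    by Aut A.  The classes whose product with the dual class of the i-th hub is
    zero are those supported on the i-th star, so there are 2^(i + 3) of them.
    For a nonzero class that is not dual to a hub there are at most 4.  Hence
    every automorphism fixes the dual class of each hub. *)

Set Implicit Arguments.
Unset Strict Implicit.
Unset Printing Implicit Defensive.

Import GRing.Theory Num.Theory.
Local Open Scope ring_scope.
Local Open Scope group_scope.
Local Open Scope quotient_scope.

(** * Integer powers and integer characters *)

Lemma aut_monoid_morphism (G : groupType) (f : aut G) :
  monoid.monoid_morphism f.
Proof.
split; last exact: aut_morph.
by apply: (mulgI (f 1)); rewrite -aut_morph !mulg1.
Qed.

HB.instance Definition _ (G : groupType) (f : aut G) :=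
  isUMagmaMorphism.Build G G f (aut_monoid_morphism f).

Section IntegerPowers.
Variable G : groupType.
Implicit Types (x y : G) (m n : int).

Definition zpow x n : G :=
  match n with Posz k => x ^+ k | Negz k => x ^- k.+1 end.

Lemma zpow1 x : zpow x 1%R = x.
Proof. by []. Qed.

Lemma zpow_succ x n : zpow x (n + 1)%R = zpow x n * x.
Proof.
case: n => [k|[|k]]; first by rewrite /= addn1 expgSr.
  by rewrite /= expg0 expg1 mulVg.
have -> : (Negz k.+1 + 1 = Negz k)%R.
  by rewrite !NegzE -addn1 PoszD opprD subrK.
by rewrite /= [in RHS]expgS invgM mulgVK.
Qed.

Lemma zpowD x m n : zpow x (m + n)%R = zpow x m * zpow x n.
Proof.
have zpow_pred k : zpow x (k - 1)%R = zpow x k * x^-1.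
  by apply: (mulIg x); rewrite -zpow_succ subrK mulgVK.
elim: n => [|n IHn|n IHn]; first by rewrite addr0 mulg1.
  by rewrite -addn1 PoszD addrA !zpow_succ IHn mulgA.
by rewrite -addn1 PoszD opprD addrA !zpow_pred IHn mulgA.
Qed.

Lemma zpowN x n : zpow x (- n)%R = (zpow x n)^-1.
Proof. by apply/esym/mulg1_eq; rewrite -zpowD subrr. Qed.

Lemma zpow_commute x y n : commute x y -> commute (zpow x n) y.
Proof.
by move=> xy; apply: commute_sym; case: n => k /=;
  [|apply: commuteV]; apply: commuteX; apply: commute_sym.
Qed.

End IntegerPowers.

Lemma morph_zpow (G H : groupType) (f : UMagmaMorphism.type G H) x n :
  f (zpow x n) = zpow (f x) n.
Proof. by case: n => k; rewrite /zpow ?gmulfXVn ?gmulfXn. Qed.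

Lemma zpowM (G : groupType) (x : G) (m n : int) :
  zpow (zpow x m) n = zpow x (m * n)%R.
Proof.
elim: n => [|n IHn|n IHn]; first by rewrite mulr0.
  by rewrite -addn1 PoszD mulrDr mulr1 !zpowD IHn zpow1.
by rewrite -addn1 PoszD opprD mulrDr mulrN1 !zpowD IHn !zpowN zpow1.
Qed.

Lemma char1 (G : groupType) (c : G -> int) :
  {morph c : x y / x * y >-> (x + y)%R} -> c 1 = 0%R.
Proof. by move=> cM; apply: (addrI (c 1)); rewrite -cM mulg1 addr0. Qed.

Lemma charV (G : groupType) (c : G -> int) :
  {morph c : x y / x * y >-> (x + y)%R} -> forall x, c x^-1 = (- c x)%R.
Proof.
by move=> cM x; apply: (addrI (c x)); rewrite -cM mulgV subrr char1.
Qed.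

Lemma char_conj (G : groupType) (c : G -> int) :
  {morph c : x y / x * y >-> (x + y)%R} -> forall x a, c (x ^ a) = c x.
Proof. by move=> cM x a; rewrite /conjg !cM (charV cM) addrCA addNr addr0. Qed.

Lemma char_zpow (G : groupType) (c : G -> int) :
  {morph c : x y / x * y >-> (x + y)%R} ->
  forall x n, c (zpow x n) = (c x * n)%R.
Proof.
move=> cM x n; elim: n => [|n IHn|n IHn]; first by rewrite mulr0 (char1 cM).
  by rewrite -addn1 PoszD zpowD cM IHn zpow1 mulrDr mulr1.
by rewrite -addn1 PoszD opprD zpowD cM IHn zpowN (charV cM) zpow1 mulrDr mulrN1.
Qed.

(** * Half-transvections *)

Section HalfTransvections.
Variables (G : groupType) (z : G) (ez : G -> int).
Hypothesis ezM : {morph ez : x y / x * y >-> (x + y)%R}.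
Hypothesis ez_z : ez z = 1%R.
Hypothesis zC : forall x, commute z x.
Hypothesis centerP : forall c, (forall x, commute c x) -> c = zpow z (ez c).
Implicit Types (f g : aut G) (m : G -> int).

(** The sign of the action of f on the centre. *)
Definition eps f : int := ez (f z).

Lemma aut_z f : f z = zpow z (eps f).
Proof.
apply: centerP => x; rewrite -[x](aut_inv_funVK f).
exact: gmulf_commute (zC _).
Qed.

Lemma aut_zpow f k : f (zpow z k) = zpow z (eps f * k)%R.
Proof. by rewrite (morph_zpow f) [in LHS]/= aut_z zpowM. Qed.

Lemma eps1 : eps 1 = 1%R.
Proof. exact: ez_z. Qed.

Lemma epsM f g : eps (f * g) = (eps f * eps g)%R.
Proof.
rewrite {1}/eps -[(f * g) z]/(f (g z)) aut_z aut_zpow (char_zpow ezM).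
by rewrite ez_z mul1r.
Qed.

Lemma eps_sign f : eps f = 1%R \/ eps f = (- 1)%R.
Proof.
have : (eps f^-1%g * eps f)%R = 1%R by rewrite -epsM mulVg eps1.
by move/intUnitRing.unitzPl => /orP[] /eqP; [left | right].
Qed.

(** The homomorphisms m for which conjugation by the square root of the
    transvection x |-> x * z^(m x) preserves Aut G. *)
Definition half_char m : Prop :=
  [/\ {morph m : x y / x * y >-> (x + y)%R}, m z = 0%R
    & forall f x, (2 %| m (f x) - m x)%Z].

Lemma half_charB m m' :
  half_char m -> half_char m' -> half_char (fun x => m x - m' x)%R.
Proof.
case=> mM mz m2 [m'M m'z m'2]; split=> [x y||f x].
- by rewrite mM m'M opprD addrACA.
- by rewrite mz m'z subrr.
have -> : (m (f x) - m' (f x) - (m x - m' x) =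
           (m (f x) - m x) - (m' (f x) - m' x))%R by ring.
by rewrite rpredB.
Qed.

Section Twist.
Variable m : G -> int.
Hypothesis Hm : half_char m.

Let mM : {morph m : x y / x * y >-> (x + y)%R}. Proof. by case: Hm. Qed.
Let mz : m z = 0%R. Proof. by case: Hm. Qed.
Let m_even f x : (2 %| m (f x) - m x)%Z. Proof. by case: Hm. Qed.

(** The exponent by which conjugation by the half-transvection changes f at x;
    [shiftE] shows that the division is exact. *)
Definition shift f x : int := ((m (f x) - eps f * m x) %/ 2)%Z.

Lemma shiftE f x : (shift f x * 2 = m (f x) - eps f * m x)%R.
Proof.
rewrite /shift divzK //; case: (eps_sign f) => ->; first by rewrite mul1r.
have -> : (m (f x) - -1 * m x = (m (f x) - m x) + m x * 2)%R by ring.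
by rewrite rpredD // dvdz_mull.
Qed.

Lemma shift_uniq f x k : (k * 2 = m (f x) - eps f * m x)%R -> shift f x = k.
Proof. by rewrite -shiftE => /esym/mulIf; apply. Qed.

Lemma m_zpow k : m (zpow z k) = 0%R.
Proof. by rewrite (char_zpow mM) mz mul0r. Qed.

Definition twist_fun f (x : G) : G := f x * zpow z (shift f x).

Lemma twist_fun_morph f : {morph twist_fun f : x y / x * y}.
Proof.
move=> x y; rewrite /twist_fun.
have -> : shift f (x * y) = (shift f x + shift f y)%R.
  by apply: shift_uniq; rewrite mulrDl !shiftE aut_morph !mM; ring.
rewrite aut_morph zpowD !mulgA; congr (_ * _); rewrite -!mulgA.
by congr (_ * _); apply/commute_sym/zpow_commute.
Qed.

Lemma twist_fun1 : twist_fun 1 =1 id.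
Proof.
by move=> x; rewrite /twist_fun (@shift_uniq _ _ 0) ?mulg1 // eps1; ring.
Qed.

Lemma twist_funM f g : twist_fun (f * g) =1 twist_fun f \o twist_fun g.
Proof.
move=> x /=; rewrite {2}/twist_fun /twist_fun.
have -> : shift f (g x * zpow z (shift g x)) = shift f (g x).
  apply: shift_uniq; rewrite shiftE aut_morph aut_zpow !mM !m_zpow; ring.
rewrite aut_morph aut_zpow -mulgA -zpowD; congr (_ * zpow z _).
apply: shift_uniq; rewrite mulrDl -mulrA !shiftE epsM /=; ring.
Qed.

Lemma twist_subproof f : is_aut (twist_fun f).
Proof.
apply/asboolP; split; first exact: twist_fun_morph.
by exists (twist_fun f^-1) => x;
  rewrite -[LHS]/((twist_fun _ \o twist_fun _) x) -twist_funM
    (mulVg, mulgV) twist_fun1.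
Qed.

Definition twist f : aut G := MkAut (twist_subproof f).

Lemma twistM : {morph twist : f g / f * g}.
Proof. by move=> f g; apply: autP => x; apply: twist_funM. Qed.

(** An inner automorphism fixes z and does not change the value of m, so the
    half-transvection commutes with it.  This is why the twist acts on Out G. *)
Lemma twist_inner f : inner f -> twist f = f.
Proof.
case=> a fa; apply: autP => x; rewrite /= /twist_fun.
have -> : shift f x = 0%R; last by rewrite mulg1.
apply: shift_uniq; have -> : eps f = 1%R.
  by rewrite /eps fa (char_conj ezM).
by rewrite fa (char_conj mM); ring.
Qed.

End Twist.

(** Half-transvections multiply like their characters; in particular the twist
    by -m inverts the twist by m. *)
Lemma twist_add m m' m'' (Hm : half_char m) (Hm' : half_char m')
    (Hm'' : half_char m'') f :
  (forall x, m'' x = m x + m' x) -> twist Hm (twist Hm' f) = twist Hm'' f.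
Proof.
move=> Dm''; have [mM mz _] := Hm; have [m'M m'z _] := Hm'.
have eps_t : eps (twist Hm' f) = eps f.
  rewrite /eps /= /twist_fun (@shift_uniq _ Hm' f z 0).
    by rewrite mulg1.
  by rewrite aut_z (m_zpow Hm') m'z; ring.
apply: autP => x; rewrite /= {1}/twist_fun /= /twist_fun -mulgA -zpowD.
congr (_ * zpow z _); apply/esym/(shift_uniq Hm'').
rewrite mulrDl !(shiftE Hm) (shiftE Hm') !Dm'' eps_t /=.
by rewrite /twist_fun mM (m_zpow Hm); ring.
Qed.

Lemma half_char0 : half_char (fun=> 0).
Proof. by split=> // *; rewrite ?addr0 ?subrr. Qed.

Lemma half_charN m : half_char m -> half_char (fun x => - m x).
Proof.
case=> mM mz m2; split=> [x y||f x]; first by rewrite mM opprD.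
  by rewrite mz oppr0.
by rewrite -opprD rpredN.
Qed.

Lemma twist0 f : twist half_char0 f = f.
Proof.
apply: autP => x; rewrite /= /twist_fun (@shift_uniq _ half_char0 f x 0).
  by rewrite mulg1.
by ring.
Qed.

Lemma twistK m (Hm : half_char m) :
  cancel (twist Hm) (twist (half_charN Hm)).
Proof.
move=> f; rewrite (@twist_add _ _ _ _ _ half_char0) ?twist0 // => x.
by rewrite addNr.
Qed.

Lemma twistNK m (Hm : half_char m) :
  cancel (twist (half_charN Hm)) (twist Hm).
Proof.
move=> f; rewrite (@twist_add _ _ _ _ _ half_char0) ?twist0 // => x.
by rewrite addrN.
Qed.

Lemma twist_is_aut m (Hm : half_char m) : is_aut (twist Hm).
Proof.
apply/asboolP; split; first exact: twistM.
by exists (twist (half_charN Hm)); [exact: twistK | exact: twistNK].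
Qed.

Definition twist_aut m (Hm : half_char m) : aut (aut G) :=
  MkAut (twist_is_aut Hm).

Definition twist_out_fun m (Hm : half_char m) (a : out G) : out G :=
  \pi_(out G) (twist Hm (repr a)).

(** By [twist_inner], the twist does not depend on the representative. *)
Lemma twist_out_pi m (Hm : half_char m) f :
  twist_out_fun Hm (\pi_(out G) f) = \pi_(out G) (twist Hm f).
Proof.
apply/outP; set f' := repr _.
have ff' : inner (f'^-1 * f) by apply/outP; rewrite reprK.
have -> : twist Hm f = twist Hm f' * (f'^-1 * f).
  by rewrite -[in RHS](twist_inner Hm ff') -twistM mulVKg.
by rewrite mulKg.
Qed.

Lemma twist_out_is_aut m (Hm : half_char m) : is_aut (twist_out_fun Hm).
Proof.
apply/asboolP; split.
  elim/quotW=> f; elim/quotW=> g.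
  rewrite -[_ * _]/(out_mul _ _) out_mul_pi !twist_out_pi.
  by rewrite -[RHS]/(out_mul _ _) out_mul_pi twistM.
exists (twist_out_fun (half_charN Hm)); elim/quotW=> f; rewrite !twist_out_pi.
  by rewrite twistK reprK.
by rewrite twistNK reprK.
Qed.

Definition twist_out m (Hm : half_char m) : aut (out G) :=
  MkAut (twist_out_is_aut Hm).

(** The automorphism that detects twists: it sends z to its inverse and moves
    every x by an even power of z. *)
Definition flip_fun x := x * zpow z (- (2 * ez x)%R).

Lemma ez_flip x : ez (flip_fun x) = - ez x.
Proof. by rewrite ezM (char_zpow ezM) ez_z; ring. Qed.

Lemma flip_is_aut : is_aut flip_fun.
Proof.
apply/asboolP; split.
  move=> x y; rewrite /flip_fun ezM mulrDr opprD zpowD !mulgA.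
  congr (_ * _); rewrite -!mulgA; congr (_ * _).
  by apply/commute_sym/zpow_commute.
by exists flip_fun => x; rewrite {1}/flip_fun ez_flip /flip_fun -mulgA -zpowD
  mulrN opprK addNr mulg1.
Qed.

Definition flip : aut G := MkAut flip_is_aut.

(** Compare the exponents of z on both sides: a conjugate of the flip moves x by
    an even power of z, up to conjugacy in G, and the twist adds m x. *)
Lemma twist_flip_even m (Hm : half_char m) g :
  (exists a, forall x, twist Hm flip x = (g^-1 * flip * g) x ^ a) ->
  forall x, (2 %| m x)%Z.
Proof.
case=> a Hg x; have := congr1 ez (Hg x); rewrite (char_conj ezM).
have [mM mz _] := Hm.
have eps_flip : eps flip = -1 by rewrite /eps ez_flip ez_z.
have m_flip : m (flip x) = m x by rewrite /= mM (char_zpow mM) mz mul0r addr0.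
rewrite /= /twist_fun (@shift_uniq _ Hm flip x (m x)); last first.
  by rewrite eps_flip m_flip; ring.
rewrite ezM (char_zpow ezM) ez_z mul1r ez_flip.
have -> : aut_inv_fun g (flip_fun (g x)) =
    x * zpow z (eps g^-1%g * - (2 * ez (g x)))%R.
  rewrite -[aut_inv_fun g]/(aut_fun g^-1) /flip_fun aut_morph aut_zpow.
  by congr (_ * _); rewrite /= aut_inv_funK.
rewrite ezM (char_zpow ezM) ez_z mul1r => ez_eq.
have -> : m x = ((ez x - eps g^-1%g * ez (g x)) * 2)%R by lia.
exact: dvdz_mull.
Qed.

Lemma card_gt_inj (T : Type) n (f : nat -> T) :
  (forall i j, (i <= n)%N -> (j <= n)%N -> f i = f j -> i = j) -> card_gt T n.
Proof.
move=> f_inj; have [g] : $|{injfun `I_n.+1 >-> [set: T]}|.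
  by apply/injfunPex; exists f => // i j; rewrite !inE /= !ltnS => *;
    apply: f_inj.
exact: inj_card_le.
Qed.

(** If the twists by m i and m j agree up to an inner automorphism of Aut G, or
    of Out G, then the twist by m j - m i is inner, and this difference is even
    by [twist_flip_even]. *)
Theorem card_gt_out_aut_out n (m : nat -> G -> int) :
  (forall i, half_char (m i)) ->
  (forall i j, (i <= n)%N -> (j <= n)%N ->
     (forall x, (2 %| m i x - m j x)%Z) -> i = j) ->
  card_gt (out (aut G)) n /\ card_gt (out (out G)) n.
Proof.
move=> Hm m_inj.
pose Hd i j := half_charB (Hm j) (Hm i).
have twistB i j f : (twist_aut (Hm i))^-1 (twist (Hm j) f) = twist (Hd i j) f.
  apply: (can_inj (aut_inv_funK (twist_aut (Hm i)))).
  rewrite [LHS]aut_inv_funVK; apply/esym/twist_add => x.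
  by rewrite addrCA addrN addr0.
split.
  apply: (@card_gt_inj _ _ (fun i => \pi_(out (aut G)) (twist_aut (Hm i)))).
  move=> i j ni nj /outP[g Hg]; apply/esym/m_inj => // x.
  apply: (@twist_flip_even _ (Hd i j) g); exists 1 => y.
  rewrite conjg1; have := congr1 (fun f : aut G => f y) (Hg flip).
  rewrite -(twistB i j flip).
  by rewrite /conjg mulgA => <-.
apply: (@card_gt_inj _ _ (fun i => \pi_(out (out G)) (twist_out (Hm i)))).
move=> i j ni nj /outP[a Ha]; apply/esym/m_inj => // x.
have: \pi_(out G) (twist (Hd i j) flip) = (\pi_(out G) flip) ^ a.
  rewrite -Ha; apply: (can_inj (aut_inv_funK (twist_out (Hm i)))).
  rewrite [RHS]aut_inv_funVK [LHS]twist_out_pi [RHS]twist_out_pi.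
  rewrite -(twistB i j flip).
  by congr (\pi_(out G) _); apply: (aut_inv_funVK (twist_aut (Hm i))).
rewrite -[a]reprK; move: (repr a) => g.
have -> : (\pi_(out G) flip) ^ (\pi_(out G) g) =
    \pi_(out G) (g^-1 * flip * g) :> out G.
  rewrite conjgE -[LHS]/(out_mul (out_inv _) (out_mul _ _)).
  by rewrite out_inv_pi (out_mul_pi flip g) (out_mul_pi g^-1) mulgA.
move=> /esym/outP; set h : aut G := g^-1 * flip * g => -[b Hb].
apply: (@twist_flip_even _ (Hd i j) g); exists (h b) => y.
by rewrite -/h -(gmulfJ h y b) -Hb; apply/esym/(aut_inv_funVK h).
Qed.

End HalfTransvections.

(** * Homomorphisms, retractions and exponents *)

Section Raag.
Variable X : sgraph.
Implicit Types (u v : X) (b c : bool) (l : X * bool) (g h : raag X).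
Implicit Types (U W : {set X}).

Definition gen l : raag X := \pi_(presented (@raag_rel X)) [:: l].

Lemma pi_cons l w : \pi_(presented (@raag_rel X)) (l :: w) =
  gen l * \pi_(presented (@raag_rel X)) w :> raag X.
Proof. by rewrite -[RHS]/(pres_mul _ _) pres_mul_pi. Qed.

Lemma raag_ind (P : raag X -> Prop) :
  P 1 -> (forall l g, P g -> P (gen l * g)) -> forall g, P g.
Proof.
move=> P1 PM; elim/quotW; elim=> [|l w IHw]; first exact: P1.
by rewrite pi_cons; apply: PM.
Qed.

Lemma gen_negb v b : gen (v, ~~ b) = (gen (v, b))^-1.
Proof.
apply/esym/mulg1_eq; rewrite -[LHS]/(pres_mul _ _) pres_mul_pi.
exact/presP/pres_cancel.
Qed.

Lemma genN v : gen (v, false) = (gen (v, true))^-1.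
Proof. exact: gen_negb v true. Qed.

Lemma gen_commute u v b c : adj u v -> commute (gen (u, b)) (gen (v, c)).
Proof.
move=> uv; have uvC : commute (gen (u, true)) (gen (v, true)).
  rewrite /commute -[LHS]/(pres_mul _ _) -[RHS]/(pres_mul _ _) !pres_mul_pi.
  by apply/presP/pres_rel; exists u, v.
by case: b c => -[]; rewrite ?genN //;
  do ?[apply: commuteV | apply: commute_sym; apply: commuteV];
  rewrite // /commute ?uvC.
Qed.

(** The target of the universal property is a monoid: the integers, self-maps
    of a set and Heisenberg triples are then covered without endowing them with
    a multiplicative group structure. *)
Section Lift.
Variables (T : Type) (idx : T) (op : Monoid.law idx) (phi : X * bool -> T).

Definition lift g : T := \big[op/idx]_(l <- repr g) phi l.

Hypothesis phi_cancel : forall v b, op (phi (v, b)) (phi (v, ~~ b)) = idx.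
Hypothesis phi_comm : forall u v, adj u v ->
  op (phi (u, true)) (phi (v, true)) = op (phi (v, true)) (phi (u, true)).

Lemma lift_pi w :
  lift (\pi_(presented (@raag_rel X)) w) = \big[op/idx]_(l <- w) phi l.
Proof.
rewrite /lift; set w' := repr _.
have: pres_cong (@raag_rel X) w' w by apply/presP; rewrite reprK.
elim=> // {w w'}
  [u v w _ -> //|u u' v v' _ uu' _ vv'|x b|_ _ [x [y [xy -> ->]]]].
- by rewrite !big_cat uu' vv'.
- by rewrite !big_cons big_nil Monoid.mulm1 phi_cancel.
by rewrite !big_cons big_nil !Monoid.mulm1 phi_comm.
Qed.

Lemma lift1 : lift 1 = idx.
Proof.
by rewrite -[1]/(\pi_(presented (@raag_rel X)) [::]) lift_pi big_nil.
Qed.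

Lemma lift_gen l : lift (gen l) = phi l.
Proof. by rewrite lift_pi big_cons big_nil Monoid.mulm1. Qed.

Lemma liftM : {morph lift : g h / g * h >-> op g h}.
Proof.
elim/quotW=> w; elim/quotW=> w'.
by rewrite -[_ * _]/(pres_mul _ _) pres_mul_pi !lift_pi big_cat.
Qed.

End Lift.

(** The retraction of A_X onto the subgroup generated by U, which kills the
    other vertices. *)
Definition ret U g : raag X :=
  lift *%g (fun l => if l.1 \in U then gen l else 1) g.

Lemma ret_cancel U v b :
  (if (v, b).1 \in U then gen (v, b) else 1) *
  (if (v, ~~ b).1 \in U then gen (v, ~~ b) else 1) = 1.
Proof. by rewrite /=; case: ifP => _; rewrite ?mulg1 // gen_negb mulgV. Qed.

Lemma ret_comm U u v : adj u v ->
  (if (u, true).1 \in U then gen (u, true) else 1) *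
  (if (v, true).1 \in U then gen (v, true) else 1) =
  (if (v, true).1 \in U then gen (v, true) else 1) *
  (if (u, true).1 \in U then gen (u, true) else 1).
Proof.
by move=> uv /=; do 2!case: ifP => _; rewrite ?mulg1 ?mul1g // gen_commute.
Qed.

Lemma ret1 U : ret U 1 = 1.
Proof. exact: lift1 (ret_cancel U) (@ret_comm U). Qed.

Lemma retM U : {morph ret U : g h / g * h}.
Proof. exact: liftM (ret_cancel U) (@ret_comm U). Qed.

Lemma ret_gen U l : ret U (gen l) = if l.1 \in U then gen l else 1.
Proof. exact: lift_gen (ret_cancel U) (@ret_comm U) l. Qed.

Lemma ret_set0 g : ret finset.set0 g = 1.
Proof.
elim/raag_ind: g => [|l g IHg]; first exact: ret1.
by rewrite retM ret_gen inE mul1g.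
Qed.

Lemma ret_setT g : ret [set: X]%SET g = g.
Proof.
elim/raag_ind: g => [|l g IHg]; first exact: ret1.
by rewrite retM ret_gen inE IHg.
Qed.

Lemma ret_ret U W g : ret U (ret W g) = ret (U :&: W) g.
Proof.
elim/raag_ind: g => [|l g IHg]; first by rewrite !ret1.
rewrite !retM IHg !ret_gen inE andbC.
by case: ifP => _; rewrite ?ret1 ?ret_gen.
Qed.

Lemma ret_commute U W g h :
  {in U & W, forall u v, adj u v} -> commute (ret U g) (ret W h).
Proof.
move=> UW; elim/raag_ind: g => [|[u b] g IHg].
  by rewrite ret1; apply/commute_sym/commute1.
rewrite retM ret_gen /=; case: ifP => uU; last by rewrite mul1g.
apply/commute_sym/commuteM; last exact/commute_sym.
elim/raag_ind: h {IHg} => [|[v c] h IHh].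
  by rewrite ret1; apply/commute_sym/commute1.
rewrite retM ret_gen /=; case: ifP => vW; last by rewrite mul1g.
apply/commute_sym/commuteM; last exact/commute_sym.
exact: gen_commute (UW u v uU vW).
Qed.

(** If every vertex of U is adjacent to every vertex of W, then U and W generate
    commuting subgroups, so both sides are homomorphisms in g. *)
Lemma ret_join U W g :
  {in U & W, forall u v, adj u v} -> ret (U :|: W) g = ret U g * ret W g.
Proof.
move=> UW; elim/raag_ind: g => [|[v b] g IHg]; first by rewrite !ret1 mulg1.
rewrite !retM IHg !ret_gen /= inE.
have vUW : v \in U -> v \in W -> False.
  by move=> vU /(UW v v vU); rewrite adj_irr.
case: (boolP (v \in U)) vUW => vU; case: (boolP (v \in W)) => vW //=.
- by move/(_ isT isT).
- by rewrite mul1g !mulgA.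
- move=> _; rewrite mul1g !mulgA; congr (_ * _).
  by have := ret_commute g (gen (v, b)) UW; rewrite ret_gen /= vW => ->.
by rewrite !mul1g.
Qed.

(** The abelianization.  Polynomials encode the free abelian group on the
    vertices, the monomial of degree [enum_rank v] standing for v; the ping-pong
    argument relies on their degrees. *)
Definition ab : raag X -> {poly int} :=
  lift +%R (fun l => if l.2 then 'X^(enum_rank l.1) else - 'X^(enum_rank l.1)).

Fact ab_cancel v b :
  (if (v, b).2 then 'X^(enum_rank v) else - 'X^(enum_rank v)) +
  (if (v, ~~ b).2 then 'X^(enum_rank v) else - 'X^(enum_rank v)) = 0
  :> {poly int}.
Proof. by case: b; rewrite /= ?addrN ?addNr. Qed.

Lemma ab1 : ab 1 = 0.
Proof. by apply: lift1 ab_cancel _ => *; apply: addrC. Qed.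

Lemma abM : {morph ab : g h / g * h >-> g + h}.
Proof. by apply: liftM ab_cancel _ => *; apply: addrC. Qed.

Lemma ab_gen l :
  ab (gen l) = if l.2 then 'X^(enum_rank l.1) else - 'X^(enum_rank l.1).
Proof. by apply: lift_gen ab_cancel _ l => *; apply: addrC. Qed.

Definition expo v g : int := (ab g)`_(enum_rank v).

Lemma expo1 v : expo v 1 = 0.
Proof. by rewrite /expo ab1 coef0. Qed.

Lemma expoM v : {morph expo v : g h / g * h >-> g + h}.
Proof. by move=> g h; rewrite /expo abM coefD. Qed.

Lemma expo_gen v u b :
  expo v (gen (u, b)) = if v == u then (if b then 1 else - 1)%R else 0.
Proof.
rewrite /expo ab_gen /=.
have := inj_eq (@enum_rank_inj X) v u; rewrite -val_eqE /= => vu.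
by case: b; rewrite ?coefN coefXn vu; case: eqP.
Qed.

Lemma ret_set1 v g : ret [set v]%SET g = zpow (gen (v, true)) (expo v g).
Proof.
elim/raag_ind: g => [|[u b] g IHg]; first by rewrite ret1 expo1.
rewrite retM ret_gen expoM zpowD IHg inE /= eq_sym expo_gen.
by case: eqP => [->|_] //; case: b; rewrite // zpowN genN.
Qed.

(** A clique generates a free abelian group, in which an element is determined
    by its exponents. *)
Lemma ret_clique_eq1 U g :
  {in U &, forall u v, u != v -> adj u v} -> {in U, forall v, expo v g = 0} ->
  ret U g = 1.
Proof.
have [n] := ubnP #|U|; elim: n U => // n IHn U.
case: (set_0Vmem U) => [-> _ _ _|[v vU]]; first exact: ret_set0.
rewrite (finset.cardsD1 v) vU ltnS => leUn Uclique Uexp.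
rewrite -(finset.setD1K vU) ret_join => [|u w].
  rewrite ret_set1 Uexp // mul1g IHn //.
    by move=> u w /setD1P[_ uU] /setD1P[_ wU]; apply: Uclique.
  by move=> u /setD1P[_ uU]; apply: Uexp.
by rewrite !inE => /eqP-> /andP[wv wU]; apply: Uclique; rewrite // eq_sym.
Qed.

End Raag.

(** * Ping-pong for a free product of two free abelian groups *)

HB.instance Definition _ (V : Type) :=
  Monoid.isLaw.Build (V -> V) id (@comp V V V)
    (fun _ _ _ => erefl) (fun _ => erefl) (fun _ => erefl).

Section PingPong.
Variables (X : sgraph) (U : bool -> {set X}) (base : bool -> X).
Hypothesis Uclique : forall c, {in U c &, forall u v, u != v -> adj u v}.
Hypothesis Udisjoint : forall c v, v \in U c -> v \in U (~~ c) = false.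
Hypothesis Unonadj : {in U true & U false, forall u v, adj u v = false}.
Hypothesis baseU : forall c, base c \in U c.
Implicit Types (u v : X) (b c : bool) (l : X * bool) (g h : raag X).

Local Notation vec := (bool -> {poly int}).

(** The elementary transvection of the pair f that adds p times the coordinate
    [~~ c] to the coordinate c. *)
Definition shear c (p : {poly int}) (f : vec) : vec :=
  fun d => f d + (if d == c then p * f (~~ d) else 0)%R.

Lemma shear0 c : shear c 0 = id.
Proof.
by apply: funext => f; apply: funext => d; rewrite /shear mul0r if_same addr0.
Qed.

Lemma shearD c p q : shear c p \o shear c q = shear c (p + q).
Proof.
apply: funext => f; apply: funext => d; rewrite /shear /=; case: eqP => [->|_].
  have -> : (~~ c == c) = false by case: (c).
  by rewrite addr0 -addrA -mulrDl [q + p]addrC.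
by rewrite !addr0.
Qed.

(** The factor 'X makes the coefficients of all nontrivial syllables
    nonconstant, as [shear_dominates] requires. *)
Definition letter_act l : vec -> vec :=
  if l.1 \in U true then shear true ('X * ab (gen l))%R
  else if l.1 \in U false then shear false ('X * ab (gen l))%R else id.

Lemma letter_actE c l :
  l.1 \in U c -> letter_act l = shear c ('X * ab (gen l))%R.
Proof.
by rewrite /letter_act; case: c => lU; rewrite ?(Udisjoint lU) lU.
Qed.

Definition act : raag X -> vec -> vec := lift (@comp vec vec vec) letter_act.

Lemma letter_act_cancel v b :
  letter_act (v, b) \o letter_act (v, ~~ b) = id.
Proof.
have ab0 : ('X * ab (gen (v, b)) + 'X * ab (gen (v, ~~ b)) = 0)%R.
  by rewrite -mulrDr -abM gen_negb mulgV ab1 mulr0.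
rewrite /letter_act /=.
by case: ifP => _; last case: ifP => _ //; rewrite shearD ab0 shear0.
Qed.

Lemma letter_act_comm u v : adj u v ->
  letter_act (u, true) \o letter_act (v, true) =
  letter_act (v, true) \o letter_act (u, true).
Proof.
move=> uv; rewrite /letter_act /=.
have vu : adj v u by rewrite adj_sym.
have noadj w x : w \in U true -> x \in U false -> adj w x -> False.
  by move=> wT xF; rewrite Unonadj.
case: (boolP (u \in U true)) => uT; case: (boolP (v \in U true)) => vT;
  case: (boolP (u \in U false)) => uF; case: (boolP (v \in U false)) => vF;
  rewrite ?shearD 1?addrC //; by [case: (noadj u v) | case: (noadj v u)].
Qed.

Lemma act1 : act 1 = id.
Proof. exact: lift1 letter_act_cancel letter_act_comm. Qed.

Lemma actM g h : act (g * h) = act g \o act h.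
Proof. exact: liftM letter_act_cancel letter_act_comm g h. Qed.

Lemma act_gen l : act (gen l) = letter_act l.
Proof. exact: lift_gen letter_act_cancel letter_act_comm l. Qed.

Lemma act_ret c g : act (ret (U c) g) = shear c ('X * ab (ret (U c) g))%R.
Proof.
elim/raag_ind: g => [|l g IHg]; first by rewrite ret1 act1 ab1 mulr0 shear0.
rewrite retM ret_gen actM IHg; case: ifP => lU; last by rewrite act1 mul1g.
by rewrite act_gen (letter_actE lU) shearD abM mulrDr.
Qed.

Lemma act_retU g : act (ret (U true :|: U false) g) = act g.
Proof.
elim/raag_ind: g => [|l g IHg]; first by rewrite ret1.
rewrite retM ret_gen !actM IHg inE; case: ifP => // /negbT/norP[lT lF].
by rewrite act1 act_gen /letter_act (negPf lT) (negPf lF).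
Qed.

(** Products of nontrivial syllables taken alternately in the two cliques, the
    leftmost one lying in [U c] unless the product is empty. *)
Inductive alternating : bool -> raag X -> Prop :=
| alternating1 c : alternating c 1
| alternatingM c s g : ret (U c) s != 1 -> alternating (~~ c) g ->
    alternating c (ret (U c) s * g).

Lemma gen_neq1 l : gen l != 1.
Proof.
case: l => v b; apply/eqP => /(congr1 (expo v)).
by rewrite expo_gen expo1 eqxx; case: b.
Qed.

(** A letter either starts a new syllable or is absorbed by the first syllable,
    which disappears if it becomes trivial. *)
Lemma alternating_letter c d l g : l.1 \in U c -> alternating d g ->
  exists d', alternating d' (gen l * g).
Proof.
move=> lU alt_g.
have genE : gen l = ret (U c) (gen l) by rewrite ret_gen lU.
have new h : alternating (~~ c) h -> exists d', alternating d' (gen l * h).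
  move=> alt_h; exists c; rewrite genE.
  by apply: alternatingM; rewrite // -genE gen_neq1.
case: alt_g => [e|e s h s1 alt_h]; first exact/new/alternating1.
have [ec|] := eqVneq e c; last first.
  move=> ec; apply: new; have -> : ~~ c = e by case: (c) (e) ec => -[].
  exact: alternatingM.
rewrite ec in s1 alt_h *; rewrite mulgA genE -retM.
have [->|ls1] := eqVneq (ret (U c) (gen l * s)) 1.
  by exists (~~ c); rewrite mul1g.
by exists c; apply: alternatingM.
Qed.

Lemma alternating_ret g : exists c, alternating c (ret (U true :|: U false) g).
Proof.
elim/raag_ind: g => [|l g [c alt_g]].
  by exists true; rewrite ret1; apply: alternating1.
rewrite retM ret_gen inE; case: ifP => [/orP[] lU|_].
- exact: alternating_letter lU alt_g.
- exact: alternating_letter lU alt_g.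
by exists c; rewrite mul1g.
Qed.

(** The ping-pong regions.  Since [size] is 0 at the zero polynomial only, both
    coordinates of a dominated pair are nonzero. *)
Definition dominates c (f : vec) := (0 < size (f (~~ c)) < size (f c))%N.

(** The axis fixed by the shears of index [~~ c] and moved by those of index
    c. *)
Definition unit_vec c : vec := fun d => if d == c then 0%R else 1%R.

Lemma shear_dominates c (p : {poly int}) (f : vec) :
  (1 < size p)%N -> (0 < size (f (~~ c)))%N ->
  (size (f c) <= size (f (~~ c)))%N ->
  dominates c (shear c p f).
Proof.
move=> p1 f0 ff; rewrite /dominates /shear eqxx.
have -> : (~~ c == c) = false by case: (c).
rewrite addr0 f0 /=.
have szM : (size (f (~~ c)) < size (p * f (~~ c))%R)%N.
  rewrite size_mul -?size_poly_gt0 ?(ltn_trans _ p1) //.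
  by case: (size p) p1 => [|[|k]] // _; rewrite addSn /= addSn ltnS leq_addl.
by rewrite addrC size_polyDl // (leq_ltn_trans ff).
Qed.

(** The starting axis d is chosen so that the last syllable moves it into its
    region; each further syllable exchanges the two regions. *)
Lemma alternating_dominates c g : alternating c g ->
  g = 1 \/ exists d, dominates c (act g (unit_vec d)).
Proof.
elim=> {c g} [|c s g s1 _ IHg]; first by left.
right; have ab_neq0 : ab (ret (U c) s) != 0.
  apply: contraNneq s1 => ab0; rewrite -(finset.setIid (U c)) -ret_ret.
  apply/eqP/ret_clique_eq1 => [|v _]; first exact: Uclique.
  by rewrite /expo ab0 coef0.
have szX : (1 < size ('X * ab (ret (U c) s))%R)%N.
  by rewrite mulrC size_mulX ?ltnS ?size_poly_gt0.
case: IHg => [->|[d /andP[f0 ff]]].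
  exists c; rewrite mulg1 act_ret; apply: shear_dominates => //;
    by rewrite /unit_vec; case: (c); rewrite /= ?size_poly0 ?size_poly1.
exists d; rewrite actM act_ret; apply: shear_dominates => //.
  exact: ltn_trans ff.
by rewrite negbK in ff; apply: ltnW.
Qed.

(** A central element preserves the axis [unit_vec d], which is the fixed set of
    the shears of index [~~ d]; one coordinate of the image is therefore zero,
    and no region of [dominates] contains it. *)
Lemma ret_central_eq1 g :
  (forall h, commute g h) -> ret (U true :|: U false) g = 1.
Proof.
move=> gC; have [c alt_g] := alternating_ret g.
case: (alternating_dominates alt_g) => // -[d /andP[]].
rewrite act_retU => f0 fc.
have fd0 : act g (unit_vec d) d = 0.
  set u := gen (base (~~ d), true).
  have act_b : act u = shear (~~ d) ('X * ab u)%R.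
    by rewrite act_gen; apply: letter_actE; apply: baseU.
  have fix_d : act u (unit_vec d) = unit_vec d.
    rewrite act_b; apply: funext => e; rewrite /shear /unit_vec.
    by case: (d) (e) => -[]; rewrite /= ?mulr0 ?addr0.
  have := congr1 (fun h => act h (unit_vec d) (~~ d)) (gC u).
  rewrite !actM /= fix_d act_b /shear eqxx negbK => /esym/eqP.
  rewrite -subr_eq0 addrC addKr mulf_eq0 => /orP[|/eqP//].
  by rewrite mulf_eq0 polyX_eq0 ab_gen /= -size_poly_eq0 size_polyXn.
by case: (c) (d) fd0 f0 fc => -[] /= ->; rewrite size_poly0 ?ltn0.
Qed.

End PingPong.

(** * Cup products mod 2 *)

(** The unitriangular 3 x 3 matrices over F_2: (a, b, c) has a and b above the
    diagonal and c in the corner. *)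
Definition heis_mul (x y : bool * bool * bool) : bool * bool * bool :=
  (x.1.1 (+) y.1.1, x.1.2 (+) y.1.2, x.2 (+) y.2 (+) (x.1.1 && y.1.2)).

Definition heis_one : bool * bool * bool := (false, false, false).

Lemma heis_mulA : associative heis_mul.
Proof. by move=> [[[] []] []] [[[] []] []] [[[] []] []]. Qed.

Lemma heis_mul1 : left_id heis_one heis_mul.
Proof. by move=> [[[] []] []]. Qed.

Lemma heis_mulr1 : right_id heis_one heis_mul.
Proof. by move=> [[[] []] []]. Qed.

HB.instance Definition _ :=
  Monoid.isLaw.Build _ heis_one heis_mul heis_mulA heis_mul1 heis_mulr1.

Section CupProduct.
Variable X : sgraph.
Implicit Types (u v : X) (b : bool) (g h : raag X) (S T : {set X}).
Implicit Types (f : aut (raag X)).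

(** The class in H^1(A_X, F_2) with support S. *)
Definition parity S : raag X -> bool := lift addb (fun l => l.1 \in S).

Lemma parity_cancel S v b :
  ((v, b).1 \in S) (+) ((v, ~~ b).1 \in S) = false.
Proof. exact: addbb. Qed.

Lemma parity1 S : parity S 1 = false.
Proof. by apply: lift1 (parity_cancel S) _ => *; apply: addbC. Qed.

Lemma parityM S : {morph parity S : g h / g * h >-> g (+) h}.
Proof. by apply: liftM (parity_cancel S) _ => *; apply: addbC. Qed.

Lemma parity_gen S l : parity S (gen l) = (l.1 \in S).
Proof. by apply: lift_gen (parity_cancel S) _ l => *; apply: addbC. Qed.

Lemma parityV S g : parity S g^-1 = parity S g.
Proof.
by have := parityM S g g^-1; rewrite mulgV parity1; do 2!case: parity.
Qed.

(** The vanishing of the cup product of the classes with supports S and T: the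
    edges index a basis of H^2(A_X, F_2), in which the coordinate of the product
    at the edge uv is the sum of both sides. *)
Definition cup0 S T : bool :=
  [forall u, forall v, adj u v ==>
     ((u \in S) && (v \in T) == (v \in S) && (u \in T))].

Lemma cup0P S T : reflect
  (forall u v, adj u v -> (u \in S) && (v \in T) = (v \in S) && (u \in T))
  (cup0 S T).
Proof.
apply: (iffP forallP) => [ST u v uv|ST u].
  by have /forallP/(_ v)/implyP/(_ uv)/eqP := ST u.
by apply/forallP => v; apply/implyP => uv; apply/eqP/ST.
Qed.

(** If the cup product is zero, then the two classes are the entries above the
    diagonal of a homomorphism to the Heisenberg group over F_2.  Two commuting
    Heisenberg matrices satisfy this identity. *)
Lemma cup0_commute S T g h : cup0 S T -> commute g h ->
  parity S g && parity T h = parity S h && parity T g.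
Proof.
move=> /cup0P ST gh.
(* The inverse of (a, b, 0) is (a, b, ab). *)
pose phi (l : X * bool) :=
  (l.1 \in S, l.1 \in T, [&& ~~ l.2, l.1 \in S & l.1 \in T]).
have phi_cancel v b : heis_mul (phi (v, b)) (phi (v, ~~ b)) = heis_one.
  by rewrite /phi /=; case: b; case: (v \in S); case: (v \in T).
have phi_comm u v : adj u v -> heis_mul (phi (u, true)) (phi (v, true)) =
    heis_mul (phi (v, true)) (phi (u, true)).
  move=> /ST; rewrite /phi /heis_mul /= => ->.
  by rewrite addbC [(u \in T) (+) _]addbC.
pose heis := lift heis_mul phi.
have heisM k k' : heis (k * k') = heis_mul (heis k) (heis k').
  exact: liftM phi_cancel phi_comm k k'.
have heisE k : (heis k).1 = (parity S k, parity T k).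
  elim/raag_ind: k => [|l k IHk].
    by rewrite !parity1 /heis (lift1 phi_cancel phi_comm).
  rewrite heisM !parityM !parity_gen /heis_mul IHk /heis.
  by rewrite (lift_gen phi_cancel phi_comm).
have := congr1 (fun k => (heis k).2) gh.
rewrite !heisM /= !heisE /= [(heis h).2 (+) _]addbC.
exact: addbI.
Qed.

(** The action of Aut(A_X) on H^1(A_X, F_2). *)
Definition pull f S : {set X} := [set v | parity S (f (gen (v, true)))].

Lemma parity_pull f S g : parity (pull f S) g = parity S (f g).
Proof.
elim/raag_ind: g => [|[v b] g IHg]; first by rewrite parity1 gmulf1 parity1.
rewrite parityM IHg aut_morph parityM; congr (_ (+) _).
rewrite parity_gen inE /=; case: b => //.
by rewrite genN (gmulfV f) parityV.
Qed.

Lemma pullK f : cancel (pull f) (pull f^-1).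
Proof.
move=> S; apply/setP => v; rewrite inE parity_pull.
by rewrite /= aut_inv_funVK parity_gen.
Qed.

Lemma pull_cup0 f S T : cup0 S T -> cup0 (pull f S) (pull f T).
Proof.
move=> ST; apply/cup0P => u v uv; rewrite !inE.
by apply: cup0_commute => //; apply: (gmulf_commute f); apply: gen_commute.
Qed.

Definition cup_kernel S : {set {set X}} := [set T | cup0 S T].

Lemma card_cup_kernel_pull f S :
  (#|cup_kernel S| <= #|cup_kernel (pull f S)|)%N.
Proof.
rewrite -(card_imset _ (can_inj (pullK f))).
apply/subset_leq_card/fintype.subsetP.
by move=> _ /imsetP[T + ->]; rewrite !inE; apply: pull_cup0.
Qed.

Lemma pull_set0 f : pull f finset.set0 = finset.set0.
Proof.
apply/setP => v; rewrite !inE; elim/raag_ind: (f _) => [|l g IHg].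
  exact: parity1.
by rewrite parityM parity_gen inE.
Qed.

Lemma parity_set1 v g : parity [set v] g = ~~ (2 %| expo v g)%Z.
Proof.
elim/raag_ind: g => [|[u b] g IHg]; first by rewrite parity1 expo1.
rewrite parityM IHg parity_gen expoM expo_gen /= inE eq_sym.
case: (v =P u) => _; last by rewrite add0r.
by case: b; lia.
Qed.

End CupProduct.

(** * Graphs whose complement is a union of stars *)

Section StarGraph.
Variable N : nat.

(** The apex is [None]; the element 0 of the i-th summand is the hub of the i-th
    star of the complement, and its other elements are the leaves.  The numbers
    of leaves are distinct so that no automorphism permutes the stars, and at
    least 2 so that 2^(i + 3) exceeds the bound 4 of [card_cup_kernel_small]. *)
Definition star_vertex : finType := option {i : 'I_N & 'I_i.+3}.
Implicit Types (u v w : star_vertex) (i : 'I_N).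

Definition block v : option 'I_N := omap tag v.
Definition is_hub v : bool :=
  if v is Some s then tagged s == 0%N :> nat else false.

Definition star_adj u v : bool :=
  (u != v) && ((block u != block v) || (is_hub u == is_hub v)).

Lemma star_adj_sym : symmetric star_adj.
Proof.
move=> u v; rewrite /star_adj eq_sym.
by rewrite [block u == _]eq_sym [is_hub u == _]eq_sym.
Qed.

Lemma star_adj_irr : irreflexive star_adj.
Proof. by move=> u; rewrite /star_adj eqxx. Qed.

Definition star_graph : sgraph := SGraph star_adj_sym star_adj_irr.

Definition apex : star_graph := None.
Definition hub i : star_graph :=
  Some (@Tagged _ i (fun j : 'I_N => 'I_j.+3) ord0).
Definition leaf i : star_graph :=
  Some (@Tagged _ i (fun j : 'I_N => 'I_j.+3) (inord 1)).
Definition star_block i : {set star_graph} := [set v | block v == Some i].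

Lemma hub_inj : injective hub.
Proof. by move=> i j [<-]. Qed.

Lemma hub_uniq u v : block u = block v -> is_hub u -> is_hub v -> u = v.
Proof.
case: u v => [[i s]|] [[j t]|] //= [ij]; move: t; rewrite -ij => t.
move=> /eqP s0 /eqP t0; congr (Some (Tagged _ _)).
by apply/val_inj; rewrite /= s0.
Qed.

Lemma hubP v : is_hub v -> exists i, v = hub i.
Proof.
case: v => [[i s]|] // hs; exists i; exact: hub_uniq.
Qed.

Lemma block_None v : block v = None -> v = apex.
Proof. by case: v. Qed.

Lemma card_star_block i : #|star_block i| = i.+3.
Proof.
pose emb (s : 'I_i.+3) : star_graph :=
  Some (@Tagged _ i (fun j : 'I_N => 'I_j.+3) s).
have emb_inj : injective emb.
  by move=> s t [] /eqP; rewrite -tag_eqE /tag_eq eqxx tagged_asE => /eqP.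
rewrite -[RHS]card_ord -(card_imset predT emb_inj).
apply: eq_card => v; rewrite inE; apply/eqP/imsetP => [|[s _ ->] //].
by case: v => [[j s]|] //= [ji]; move: s; rewrite ji => s; exists s.
Qed.

Lemma star_adj_neq u v : block u != block v -> star_adj u v.
Proof.
by move=> uv; rewrite /star_adj uv andbT; apply: contraNneq uv => ->.
Qed.

Lemma nadj_star u v : u != v -> star_adj u v = false ->
  block u = block v /\ is_hub u != is_hub v.
Proof.
by rewrite /star_adj => -> /= /norP; rewrite negbK => -[/eqP].
Qed.

Lemma cup0_nbr (S T : {set star_graph}) u v :
  cup0 S T -> u \in S -> star_adj u v -> (v \in T) = (v \in S) && (u \in T).
Proof. by move=> /cup0P hT uS /(hT u v); rewrite uS. Qed.

(** If u belongs to S and the product of S and T is zero, then T is determined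
    by its value at u on all the neighbours of u.  If S contains a leaf or the
    apex p, all vertices but p and at most one hub are neighbours of p.  If S
    contains two hubs, which are adjacent, every other vertex is adjacent to one
    of them. *)
Lemma card_cup_kernel_small (S : {set star_graph}) :
  S != finset.set0 -> (forall i, S != [set hub i]) -> (#|cup_kernel S| <= 4)%N.
Proof.
move=> S0 Shub.
suff [p [q pqP]] : exists p q : star_graph, forall T T',
    T \in cup_kernel S -> T' \in cup_kernel S ->
    (p \in T) = (p \in T') -> (q \in T) = (q \in T') -> T = T'.
  rewrite -[4%N]/(2 * 2)%N -card_bool -card_prod.
  apply: (@leq_card_in _ _ (fun T : {set star_graph} => (p \in T, q \in T))).
  by move=> T T' hT hT' [pT qT]; apply: pqP.
have [/exists_inP[p pS hp]|] := boolP [exists p in S, ~~ is_hub p].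
  exists p, (if block p is Some i then hub i else p).
  move=> T T'; rewrite !inE => hT hT' pT qT; apply/setP => w.
  have [pw|] := boolP (star_adj p w).
    by rewrite (cup0_nbr hT pS pw) (cup0_nbr hT' pS pw) pT.
  have [<- //|/nadj_star pw /negbTE/pw[bw hw]] := eqVneq p w.
  case E : (block p) bw qT => [i|] bw.
    suff -> : w = hub i by [].
    apply: hub_uniq; rewrite -?bw //.
    by move: hw; rewrite (negPf hp); case: is_hub.
  by move: hw; rewrite (@block_None w) // (@block_None p) // eqxx.
rewrite negb_exists_in => /forall_inP hubS.
have [c cS] := set0Pn _ S0.
have [i ci] := hubP (negbNE (hubS c cS)).
have [d dS dc] : exists2 d, d \in S & d != c.
  have /subsetPn[d dS] : ~~ (S \subset [set c]).
    by rewrite subset1 (negPf S0) orbF ci.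
  by rewrite inE => dc; exists d.
have bcd : block c != block d.
  apply: contraNneq dc => bcd; apply/eqP/hub_uniq; rewrite ?bcd //.
    exact/negbNE/hubS.
  exact/negbNE/hubS.
exists c, c => T T'; rewrite !inE => hT hT' cT _; apply/setP => w.
have cd := star_adj_neq bcd.
have dT : (d \in T) = (d \in T').
  by rewrite (cup0_nbr hT cS cd) (cup0_nbr hT' cS cd) cT.
have [cw|] := boolP (star_adj c w).
  by rewrite (cup0_nbr hT cS cw) (cup0_nbr hT' cS cw) cT.
have [<- //|/nadj_star cw /negbTE/cw[bw _]] := eqVneq c w.
have dw : star_adj d w by apply: star_adj_neq; rewrite -bw eq_sym.
by rewrite (cup0_nbr hT dS dw) (cup0_nbr hT' dS dw) dT.
Qed.

(** The symmetry along the edges at the hub says that T vanishes on all its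
    neighbours, and the vertices not adjacent to the hub form its star. *)
Lemma cup_kernel_hub i : cup_kernel [set hub i] = powerset (star_block i).
Proof.
apply/setP => T; rewrite !inE.
apply/idP/fintype.subsetP => [hT v vT|Ti].
  rewrite inE; apply: contraTT vT => vi.
  have iv : star_adj (hub i) v by apply: star_adj_neq; rewrite eq_sym.
  rewrite (cup0_nbr hT _ iv) ?inE //; apply/negP => /andP[/eqP vi' _].
  by rewrite vi' eqxx in vi.
have nadj v : star_adj (hub i) v -> v \notin T.
  move=> /andP[iv]; apply: contraL => /Ti; rewrite inE => /eqP vi.
  rewrite vi eqxx /=; apply: contra iv => /eqP hv.
  by apply/eqP/hub_uniq; rewrite -?hv.
apply/cup0P => u v /= uv; rewrite !inE.
have [ui|ui] := eqVneq u (hub i); have [vi|vi] := eqVneq v (hub i) => //=.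
- by rewrite ui vi.
- by rewrite ui in uv; rewrite (negPf (nadj _ uv)).
by rewrite vi star_adj_sym in uv; rewrite (negPf (nadj _ uv)).
Qed.

(** The number of classes whose product with a given class is zero is an
    invariant, and it distinguishes the hubs from each other and from the other
    nonzero classes. *)
Lemma pull_hub (f : aut (raag star_graph)) i : pull f [set hub i] = [set hub i].
Proof.
have card_hub j : #|cup_kernel [set hub j]| = (2 ^ j.+3)%N.
  by rewrite cup_kernel_hub card_powerset card_star_block.
have pull_is_hub (f' : aut (raag star_graph)) :
    exists j, pull f' [set hub i] = [set hub j].
  have := card_cup_kernel_pull f' [set hub i]; rewrite card_hub => le_card.
  apply: contrapT => /forallNP nhub.
  have : (2 ^ i.+3 <= 4)%N.
    apply: leq_trans le_card (card_cup_kernel_small _ _).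
      rewrite -(pull_set0 f') (inj_eq (can_inj (pullK f'))).
      by apply/set0Pn; exists (hub i); rewrite inE.
    by move=> j; apply/eqP => /nhub.
  by rewrite -[4%N]/(2 ^ 2)%N leq_exp2l.
have [j fj] := pull_is_hub f; rewrite fj; congr [set hub _].
have := card_cup_kernel_pull f [set hub i].
have := card_cup_kernel_pull f^-1 [set hub j].
rewrite -fj pullK fj !card_hub !leq_exp2l // !ltnS => ji ij.
by apply/val_inj/anti_leq; rewrite ij ji.
Qed.

Lemma hub_mod2 (f : aut (raag star_graph)) i x :
  (2 %| expo (hub i) (f x) - expo (hub i) x)%Z.
Proof.
have := parity_pull f [set hub i] x; rewrite pull_hub !parity_set1.
by lia.
Qed.

End StarGraph.

Section StarCenter.
Variable N : nat.
Local Notation A := (raag (star_graph N)).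
Implicit Types (i : 'I_N) (c : A).

Lemma apex_commute (x : A) : commute (gen (apex N, true)) x.
Proof.
elim/raag_ind: x => [|[v b] x IHx]; first exact: commute1.
apply: commuteM => //; case: v => [s|]; first exact: gen_commute.
by case: b; rewrite // (genN (apex N)); apply: commuteV.
Qed.

Lemma leafE i : is_hub (leaf i) = false.
Proof. by rewrite /is_hub /= inordK. Qed.

Lemma ret_block_central c i :
  (forall x, commute c x) -> ret (star_block i) c = 1.
Proof.
move=> cC.
pose U b : {set star_graph N} := [set v in star_block i | is_hub v == b].
have -> : star_block i = U true :|: U false.
  by apply/setP => v; rewrite !inE; case: is_hub; rewrite ?andbT ?andbF ?orbF.
apply: (@ret_central_eq1 _ U (fun b => if b then hub i else leaf i)) => //.
- move=> b u v; rewrite !inE.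
  move=> /andP[/eqP ui /eqP uh] /andP[/eqP vi /eqP vh] uv.
  by rewrite /= /star_adj uv uh vh eqxx orbT.
- by move=> b v; rewrite !inE => /andP[-> /eqP->]; case: b.
- move=> u v; rewrite !inE => /andP[/eqP ui /eqP uh] /andP[/eqP vi /eqP vh].
  by rewrite /= /star_adj ui vi uh vh eqxx andbF.
by case; rewrite !inE ?leafE //= eqxx.
Qed.

(** The components of a central element along the stars are trivial by
    ping-pong; they can be removed one by one because the graph is the join of
    the apex and of these blocks. *)
Lemma star_center c :
  (forall x, commute c x) -> c = zpow (gen (apex N, true)) (expo (apex N) c).
Proof.
move=> cC; rewrite -ret_set1.
have ret_off i : ret (~: star_block i) c = c.
  have joinC : {in star_block i & ~: star_block i,
                forall u v : star_graph N, adj u v}.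
    move=> u v; rewrite !inE => /eqP ui vi; apply: star_adj_neq.
    by rewrite ui eq_sym.
  have := ret_join c joinC; rewrite finset.setUCr ret_setT => cE.
  by rewrite [RHS]cE ret_block_central ?mul1g.
have off_blocks (s : seq 'I_N) :
    ret [set v : star_graph N |
           if block v is Some i then i \notin s else true] c = c.
  elim: s => [|i s IHs].
    rewrite -[RHS]ret_setT; congr (ret _ _).
    by apply/setP => v; rewrite !inE; case: block.
  rewrite -[RHS](ret_off i) -[in RHS]IHs ret_ret; congr (ret _ _).
  apply/setP => v; rewrite !inE; case: (block v) => [j|] //=.
  by rewrite inE negb_or.
rewrite -[LHS](off_blocks (enum 'I_N)); congr (ret _ _).
by apply/setP => -[s|]; rewrite !inE /= ?mem_enum ?eqxx.
Qed.

Lemma card_star_graph : #|star_graph N| = (\sum_(i < N) i.+3).+1.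
Proof.
rewrite card_option card_tagged sumnE big_map big_enum; congr _.+1.
by apply: eq_bigr => i _; rewrite card_ord.
Qed.

End StarCenter.

Lemma star_graph_iso_inj M N :
  sgraph_iso (star_graph M) (star_graph N) -> M = N.
Proof.
have card_lt : {homo (fun k => #|star_graph k|) : a b / (a < b)%N}.
  apply: homo_ltn => [b a c|k]; first exact: ltn_trans.
  rewrite !card_star_graph big_ord_recr /= !addnS !ltnS.
  by rewrite leqW // leqW // leq_addr.
case=> f /bij_eq_card cardE _.
by case: (ltngtP M N) => // /card_lt; rewrite cardE ltnn.
Qed.

Theorem corollary3 (n : nat) (hn : (1 <= n)%N) :
  exists Gamma : nat -> sgraph,
    (forall i j : nat, i <> j -> ~ sgraph_iso (Gamma i) (Gamma j)) /\
    (forall i : nat,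
        card_gt (out (aut (raag (Gamma i)))) n /\
        card_gt (out (out (raag (Gamma i)))) n).
Proof.
(* The number of stars grows with k and is at least n + 1, so that the first
   n + 1 hubs exist in all these graphs. *)
exists (fun k => star_graph (n + k).+1); split=> [i j ij|k].
  by move=> /star_graph_iso_inj/eqP; rewrite eqSS eqn_add2l => /eqP.
pose h j : 'I_(n + k).+1 := inord j.
have hubE i j : (i <= n)%N -> (j <= n)%N -> (hub (h i) == hub (h j)) = (i == j).
  move=> ni nj; rewrite (inj_eq (@hub_inj _)) -val_eqE /= !inordK //;
    by rewrite ltnS (leq_trans _ (leq_addr _ _)).
apply: (@card_gt_out_aut_out _ (gen (apex (n + k).+1, true)) (expo (apex _))
          _ _ _ _ n (fun j => expo (hub (h j)))).
- exact: expoM.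
- by rewrite expo_gen eqxx.
- exact: apex_commute.
- exact: star_center.
- move=> j; split=> [||f x]; [exact: expoM | by rewrite expo_gen |].
  exact: hub_mod2.
move=> i j ni nj /(_ (gen (hub (h i), true))).
by rewrite !expo_gen eqxx eq_sym hubE //; case: eqP.
Qed.
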